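(* With parameter $s$, let $$x(s)= \frac{3+24s-16 s^2-(4s-1) \sqrt{16 s^2-40 s+9}}{3+24s-16 s^2+(4s-1) \sqrt{16 s^2-40 s+9}},\qquad y(s)=\frac{12-16 s}{3 + 24 s - 16 s^2+(4s-1) \sqrt{16 s^2-40 s+9}}.$$ Then $y(s)$, as a function of $x(s)$, is a solution of the Painlevé VI equation with parameters $(\alpha,\beta,\gamma,\delta)=\left(\frac18,-\frac18,\frac18,\frac38\right)$, which corresponds to a $6$-Poncelet inscribed family.
   Context: The Painlevé VI equation with parameters $(\alpha,\beta,\gamma,\delta)$ is $$\frac{d^2 y}{dx^2} = \frac{1}{2} \left( \frac{1}{y} + \frac{1}{y-1}+ \frac{1}{y-x} \right) \left( \frac{dy}{dx} \right)^2 - \left( \frac{1}{x} + \frac{1}{x-1} + \frac{1}{y-x} \right) \frac{dy}{dx}+ \frac{y(y-1)(y-x)}{x^2(x-1)^2}\left( \alpha +\beta\frac{x}{y^2} + \gamma\frac{x-1}{(y-1)^2} + \delta\frac{x(x-1)}{(y-x)^2} \right).$$ ''As a function of $x$'' means that $y$ is regarded locally as a function of $x$ through the parameter $s$ (with the same branch of the square root in all formulas), where $dx/ds\ne0$ and the terms of the equation are defined. Correspondence with a $6$-Poncelet inscribed family: consider the circle $\Gamma_0: (X-\frac12)^2+Y^2=1$ and the confocal conics $\mathcal{C}(t):\frac{X^2}{a-t}+\frac{Y^2}{a-t-\frac14}=1$ (one focus is the centre of $\Gamma_0$, the other lies on $\Gamma_0$; every non-degenerate $\mathcal{C}(t)$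 admits, in the complexified plane, closed hexagons inscribed in $\Gamma_0$ and circumscribed about $\mathcal{C}(t)$). With $s=a-t$, the associated cubic is $\mu^2=-\frac{1}{16} ((4s-1) \lambda +4)\left(4s \lambda^2 +(4 s+3) \lambda+4\right)$, with finite ramification points $\lambda_1=-\frac{4}{4s-1}$, $\lambda_{2,3}=-\frac{1}{2}-\frac{3}{8s}\pm\frac{\sqrt{16s^2-40s+9}}{8s}$. Put $x=\frac{\lambda_3-\lambda_1}{\lambda_2-\lambda_1}$ and $y_0=\frac{\lambda_1}{\lambda_1-\lambda_2}=\frac{32s}{3+24s-16 s^2+(4s-1) \sqrt{16 s^2-40 s+9}}$. Then $y$ is obtained from $y_0$ by the Okamoto transformation $y = y_0 + \frac{y_0(y_0-1)(y_0-x)}{x(x-1)\frac{dy_0}{dx} - y_0(y_0-1)}$. *)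

(* Defs.v *)
From HB Require Import structures.
From mathcomp Require Import all_boot all_order all_algebra.
From mathcomp Require Import complex.
From mathcomp Require Import all_classical all_reals all_analysis.
From mathcomp Require Import ring.

Set Implicit Arguments.
Unset Strict Implicit.
Unset Printing Implicit Defensive.

Import Order.TTheory GRing.Theory Num.Theory.
Import numFieldNormedType.Exports.

Local Open Scope ring_scope.
Local Open Scope classical_set_scope.

(* The definitions below are meant for [K = Cplx R]. [Cplx R] is R[i] seen as
   an abstract number field, which gives it the topology of the modulus; then
   [derivable f z 1] is complex differentiability at [z] and [derive1 f] is the
   complex derivative. *)
Definition Cplx (R : realType) : numFieldType := R[i].

Section Definitions.
Variable K : numFieldType.

Definition painleve6_rhs (al be ga de x y y' : K) : K :=
  2^-1 * (y^-1 + (y - 1)^-1 + (y - x)^-1) * y' ^+ 2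
  - (x^-1 + (x - 1)^-1 + (y - x)^-1) * y'
  + y * (y - 1) * (y - x) / (x ^+ 2 * (x - 1) ^+ 2)
    * (al + be * (x / y ^+ 2) + ga * ((x - 1) / (y - 1) ^+ 2)
       + de * (x * (x - 1) / (y - x) ^+ 2)).

(* The non-vanishing conditions exclude the points where a denominator of the
   equation is zero (division by zero is total in [fieldType]). *)
Definition solves_painleve6_at (al be ga de : K) (f : K -> K) (x : K) : Prop :=
  [/\ [/\ x != 0, x != 1, f x != 0, f x != 1 & f x != x],
      derivable f x 1, derivable (derive1 f) x 1
    & derive1 (derive1 f) x
      = painleve6_rhs al be ga de x (f x) (derive1 f x)].

(* Near the parameter value [s0], [y] is the holomorphic function [f] of [x];
   then dy/dx at [s0] is [derive1 f (x s0)]. *)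
Definition locally_function_of (x y : K -> K) (s0 : K) (f : K -> K) : Prop :=
  (\forall z \near x s0, derivable f z 1) /\
  (\forall s \near s0, f (x s) = y s).

(* [r] is a holomorphic branch of sqrt(16 s^2 - 40 s + 9) on the open set [U].
   The zeros 1/4 and 9/4 of the radicand are simple, so they never belong to
   [U], and elsewhere every continuous branch is holomorphic. *)
Definition sqrt_branch (U : set K) (r : K -> K) : Prop :=
  [/\ open U, (forall s, U s -> derivable r s 1)
    & forall s, U s -> r s ^+ 2 = 16 * s ^+ 2 - 40 * s + 9].

Definition den6 (r : K -> K) (s : K) : K :=
  3 + 24 * s - 16 * s ^+ 2 + (4 * s - 1) * r s.

Definition x6 (r : K -> K) (s : K) : K :=
  (3 + 24 * s - 16 * s ^+ 2 - (4 * s - 1) * r s) / den6 r s.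

Definition y6 (r : K -> K) (s : K) : K := (12 - 16 * s) / den6 r s.

Definition lambda1 (s : K) : K := - (4 / (4 * s - 1)).
Definition lambda2 (r : K -> K) (s : K) : K :=
  - 2^-1 - 3 / (8 * s) + r s / (8 * s).
Definition lambda3 (r : K -> K) (s : K) : K :=
  - 2^-1 - 3 / (8 * s) - r s / (8 * s).

Definition y0 (r : K -> K) (s : K) : K :=
  lambda1 s / (lambda1 s - lambda2 r s).

Definition okamoto_den (x y y' : K) : K := x * (x - 1) * y' - y * (y - 1).

Definition okamoto (x y y' : K) : K :=
  y + y * (y - 1) * (y - x) / okamoto_den x y y'.

(* A conic of the complex projective plane is given by a symmetric matrix [M];
   the affine point (X, Y) has homogeneous coordinates (X : Y : 1). *)
Definition homog (p : K * K) : 'rV[K]_3 := \row_j [:: p.1; p.2; 1]`_j.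

Definition conic_form (M : 'M[K]_3) (u v : 'rV[K]_3) : K :=
  (u *m M *m v^T) ord0 ord0.

Definition on_conic (M : 'M[K]_3) (p : K * K) : Prop :=
  conic_form M (homog p) (homog p) = 0.

(* For distinct [p] and [q] and invertible [M]: the line [pq] is the tangent
   to [M] at some point [T] of [M], possibly at infinity. *)
Definition line_tangent (M : 'M[K]_3) (p q : K * K) : Prop :=
  exists T : 'rV[K]_3, [/\ T != 0, conic_form M T T = 0,
    conic_form M T (homog p) = 0 & conic_form M T (homog q) = 0].

Definition poncelet_polygon (n : nat) (G M : 'M[K]_3) (P : 'I_n -> K * K) :
    Prop :=
  [/\ injective P, (forall i, on_conic G (P i))
    & forall i, line_tangent M (P i) (P (ordS i))].

Definition Gamma0 : 'M[K]_3 :=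
  \matrix_(i, j) (nth [::] [:: [:: 1; 0; - 2^-1];
                               [:: 0; 1; 0];
                               [:: - 2^-1; 0; - (3 / 4)]] i)`_j.

Definition confocal (a t : K) : 'M[K]_3 :=
  diag_mx (\row_j [:: (a - t)^-1; (a - t - 4^-1)^-1; -1]`_j).

(* The right-hand side of mu^2 = ..., i.e. the determinant of the pencil
   spanned by the confocal conic and the circle, up to a factor depending only
   on [s]. *)
Definition cubic (s la : K) : K :=
  - (16^-1) * ((4 * s - 1) * la + 4)
            * (4 * s * la ^+ 2 + (4 * s + 3) * la + 4).

Lemma on_Gamma0 (X Y : K) :
  on_conic Gamma0 (X, Y) <-> (X - 2^-1) ^+ 2 + Y ^+ 2 = 1.
Proof.
rewrite /on_conic /conic_form /homog !mxE !big_ord_recr big_ord0 /= !mxE.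
rewrite !big_ord_recr !big_ord0 /= !mxE /=.
set e := (X in X = 0 <-> _).
have -> : e = (X - 2^-1) ^+ 2 + Y ^+ 2 - 1 by rewrite /e; field.
split=> [/eqP|->]; last exact: subrr.
by rewrite subr_eq0 => /eqP.
Qed.

Lemma on_confocal (a t X Y : K) :
  on_conic (confocal a t) (X, Y) <->
  X ^+ 2 / (a - t) + Y ^+ 2 / (a - t - 4^-1) = 1.
Proof.
rewrite /on_conic /conic_form /homog !mxE !big_ord_recr big_ord0 /= !mxE.
rewrite !big_ord_recr !big_ord0 /= !mxE /=.
set e := (X in X = 0 <-> _).
have -> : e = X ^+ 2 / (a - t) + Y ^+ 2 / (a - t - 4^-1) - 1.
  by rewrite /e ?mulr1n ?mulr0n; ring.
split=> [/eqP|->]; last exact: subrr.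
by rewrite subr_eq0 => /eqP.
Qed.

End Definitions.

(* Main.v *)
Require Import Defs.
From mathcomp Require Import all_boot all_order all_algebra.
From mathcomp Require Import complex.
From mathcomp Require Import all_classical all_reals all_analysis.
From mathcomp Require Import ring.

(* The substitution 4 s - 5 = 2 (u + 1/u), sqrt(16 s^2 - 40 s + 9) = 2 (u - 1/u)
   makes everything rational in u:
     x = u^3 (u + 2) / (2 u + 1),  y = u (u^2 + u + 1) / (2 u + 1),
     y_0 = - u (u + 2),            dx/du = 6 u^2 (u + 1)^2 / (2 u + 1)^2,
   so the Painleve equation and the Okamoto formula become identities of
   rational functions of u. To see y as a function of x one inverts x(u)
   locally: x(v) = z is a monic quartic equation in v, and since the product of
   the distances from u to its roots is |2 u + 1| |z - x(u)|, one root is close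
   to u when z is close to x(u).

   With p = (X - 1/2) + i Y on the circle, the chord p q is tangent to the
   conic of parameter s iff (p + q + p q) (p + q + 1) = 4 s p q. For fixed p the
   two solutions q have product p, so consecutive vertices satisfy
   p_(n+1) p_(n-1) = p_n, a recursion of period 6. *)

Set Implicit Arguments.
Unset Strict Implicit.
Unset Printing Implicit Defensive.

Import Order.TTheory GRing.Theory Num.Theory.
Import numFieldNormedType.Exports.

Local Open Scope ring_scope.
Local Open Scope classical_set_scope.

(** * Auxiliary facts on polynomials and confocal conics *)

(** In characteristic 0 there are [size p] distinct natural numbers to try, more than [p] has
    roots. *)
Lemma exists_nonroot (K : numFieldType) (p : {poly K}) :
  p != 0 -> exists x, ~~ root p x.
Proof.
move=> p0; pose rs : seq K := [seq n%:R | n <- iota 0 (size p)].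
have urs : uniq rs.
  by rewrite map_inj_uniq ?iota_uniq // => m n /eqP; rewrite eqr_nat => /eqP.
have [/(max_poly_roots p0)/(_ urs)|] := boolP (all (root p) rs).
  by rewrite size_map size_iota ltnn.
by case/allPn=> x _ px; exists x.
Qed.

Lemma sum_ord3 (V : zmodType) (F : 'I_3 -> V) :
  \sum_i F i = F 0 + F 1 + F 2%:R.
Proof.
rewrite !big_ord_recl big_ord0 addr0 addrA.
by congr (F _ + F _ + F _); exact: val_inj.
Qed.

Lemma conic_form_confocal (K : numFieldType) (a t : K) (u v : 'rV[K]_3) :
  conic_form (confocal a t) u v =
  u 0 0 * v 0 0 / (a - t) + u 0 1 * v 0 1 / (a - t - 4^-1)
  - u 0 2%:R * v 0 2%:R.
Proof.
rewrite /conic_form /confocal mul_mx_diag mxE sum_ord3 !mxE /=.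
by rewrite mulrN1 mulNr !(mulrAC _ _ (v _ _)).
Qed.

(** * Hexagons inscribed in the circle and circumscribed about a confocal conic *)

Section CirclePoints.
Variable K : numClosedFieldType.

(* The point of Gamma0 with (X - 1/2) + i Y = p and (X - 1/2) - i Y = 1/p. *)
Definition circle_point (p : K) : K * K :=
  (2^-1 + (p + p^-1) / 2, (p - p^-1) / (2 * 'i)).

Lemma circle_point_inj : injective circle_point.
Proof.
have i0 : 'i != 0 :> K := neq0Ci K.
have eqp (p : K) : (circle_point p).1 - 2^-1 + 'i * (circle_point p).2 = p.
  rewrite /circle_point /=; set q := p^-1.
  by field; rewrite i0.
by move=> p q pq; rewrite -(eqp p) pq eqp.
Qed.

Lemma circle_point_on (p : K) : p != 0 -> on_conic (Gamma0 K) (circle_point p).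
Proof.
move=> p0; apply/on_Gamma0.
have i2 : 'i ^+ 2 = -1 :> K := sqrCi K.
have i0 : 'i != 0 :> K := neq0Ci K.
(* In this form squaring leaves only powers of i^2, which can be replaced by -1. *)
have -> : (p - p^-1) / (2 * 'i) = (p - p^-1) * 'i / (2 * 'i ^+ 2).
  by field; rewrite i0.
rewrite exprMn exprMn i2.
by field.
Qed.

(** The chord has equation (1 + p q) X + i (1 - p q) Y = p + q + (1 + p q)/2. The witness T is its
    pole with respect to the conic, and the quadratic form at T equals 4 (a - t) p q - (p + q + p q)
    (p + q + 1). *)
Lemma circle_chord_tangent (a t p q : K) :
  a - t != 0 -> a - t - 4^-1 != 0 -> p != 0 -> q != 0 ->
  (p + q + p * q) * (p + q + 1) = 4 * (a - t) * p * q ->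
  line_tangent (confocal a t) (circle_point p) (circle_point q).
Proof.
move=> s0 s14 p0 q0; set s := a - t in s0 s14 * => E.
have i0 : 'i != 0 :> K := neq0Ci K.
have i2 : 'i ^+ 2 = -1 :> K := sqrCi K.
exists (\row_j [:: s * (1 + p * q); (s - 4^-1) * ('i * (1 - p * q));
                   p + q + (1 + p * q) / 2]`_j).
have d14 : s * 4 - 1 != 0.
  have -> : s * 4 - 1 = 4 * (s - 4^-1) by field.
  by rewrite mulf_neq0 ?pnatr_eq0.
have on_chord X Y : (1 + p * q) * X + 'i * (1 - p * q) * Y
    = p + q + (1 + p * q) / 2 ->
  conic_form (confocal a t) (\row_j [:: s * (1 + p * q);
    (s - 4^-1) * ('i * (1 - p * q)); p + q + (1 + p * q) / 2]`_j)
    (homog (X, Y)) = 0.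
  rewrite conic_form_confocal !mxE /= -/s => <-.
  by field; rewrite s0 d14.
split.
- apply/eqP=> /rowP T0.
  have /eqP := T0 0; rewrite !mxE /= mulf_eq0 (negPf s0) /= => /eqP e1.
  have /eqP := T0 1; rewrite !mxE /= !mulf_eq0 (negPf s14) (negPf i0) /=.
  move=> /eqP e2.
  suff /eqP : 2 = 0 :> K by rewrite pnatr_eq0.
  have -> : 2 = (1 + p * q) + (1 - p * q) :> K by ring.
  by rewrite e1 e2 addr0.
- rewrite conic_form_confocal !mxE /= -/s.
  transitivity (s * (1 + p * q) ^+ 2
    + (s - 4^-1) * ((1 - p * q) ^+ 2 * 'i ^+ 2)
    - (p + q + (1 + p * q) / 2) ^+ 2).
    by field; rewrite s0 d14.
  transitivity (4 * s * p * q - (p + q + p * q) * (p + q + 1)).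
    by rewrite i2; field.
  by rewrite E subrr.
- apply: on_chord; field.
  by rewrite p0 i0.
apply: on_chord; field.
by rewrite q0 i0.
Qed.

(** The vertices are p, q, q/p, 1/p, 1/q, p/q, where q solves the tangency condition with p: (1 + p)
    q^2 + b q + p (1 + p) = 0. Most of the work is to choose p so generic that the six are
    distinct. *)
Lemma exists_hexagon (a t : K) : a - t != 0 -> a - t - 4^-1 != 0 ->
  exists P : 'I_6 -> K * K, poncelet_polygon (Gamma0 K) (confocal a t) P.
Proof.
move=> s0 s14; set s := a - t in s0 s14 *.
have s41 : 4 * s - 1 != 0.
  have -> : 4 * s - 1 = 4 * (s - 4^-1) by field.
  by rewrite mulf_neq0 ?pnatr_eq0.
(* Two of the six vertices coincide only if [p] is 1, -1 or a root of one of
   [B1], [B2] and [B3]. *)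
pose B1 : {poly K} := 2%:P * 'X^2 + (5 - 4 * s)%:P * 'X + 2%:P.
pose B2 : {poly K} := ('X^2 + 'X + 1) ^+ 2 - (4 * s)%:P * 'X^2.
pose B3 : {poly K} := 4%:P * 'X * (1 + 'X) ^+ 2
  - ((1 + 'X) ^+ 2 + 'X - (4 * s)%:P * 'X) ^+ 2.
(* Apart from ['X], every factor below has a nonzero constant term independent of s. *)
have nz (B : {poly K}) c : B.[0] = c -> c != 0 -> B != 0.
  by move=> <-; apply: contraNneq => ->; rewrite horner0.
have [p] : exists p, ~~ root ('X * ('X + 1) * ('X - 1) * B1 * B2 * B3) p.
  apply: exists_nonroot.
  rewrite !mulf_neq0 ?polyX_eq0 //.
  - by apply: (nz _ 1); rewrite ?oner_eq0 // !hornerE.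
  - by apply: (nz _ (-1)); rewrite ?oppr_eq0 ?oner_eq0 // !hornerE.
  - by apply: (nz _ 2); rewrite ?pnatr_eq0 // /B1 !hornerE /=; ring.
  - by apply: (nz _ 1); rewrite ?oner_eq0 // /B2 !hornerE /=; ring.
  - by apply: (nz _ (-1)); rewrite ?oppr_eq0 ?oner_eq0 // /B3 !hornerE /=; ring.
rewrite !rootM !negb_or /root !hornerE /= -!andbA.
case/and5P=> p0 pN1 p1 b1 /andP[b2 b3].
pose b := (1 + p) ^+ 2 + p - 4 * s * p.
pose d := sqrtC (b ^+ 2 - 4 * p * (1 + p) ^+ 2).
pose q := (d - b) / (2 * (1 + p)).
have p10 : 1 + p != 0 by rewrite addrC.
have E : (p + q + p * q) * (p + q + 1) - 4 * s * p * q = 0.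
  have -> : (p + q + p * q) * (p + q + 1) - 4 * s * p * q =
      (d ^+ 2 - (b ^+ 2 - 4 * p * (1 + p) ^+ 2)) / (4 * (1 + p)).
    by rewrite /q /b; field; rewrite p10.
  by rewrite sqrtCK subrr mul0r.
clearbody q => {b d}.
(* From here to [dpq2], substituting a forbidden relation between p and q into the tangency equation
   would make a product of nonzero factors vanish. *)
have q0 : q != 0.
  apply: contraTneq (mulf_neq0 p0 p10) => q0; apply/negPn/eqP.
  by rewrite -[RHS]E q0; ring.
have dqN1 : q + 1 != 0.
  apply: contraNneq (mulf_neq0 p0 s41) => e.
  have {}e : q = -1 by apply/eqP; rewrite -addr_eq0 e.
  by apply/eqP; rewrite -[RHS]E e; ring.
have dpDq : p + q != 0.
  apply: contraNneq (mulf_neq0 (expf_neq0 2 p0) s41) => e.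
  have {}e : q = - p by apply/eqP; rewrite -addr_eq0 addrC e.
  by apply/eqP; rewrite -[RHS]E e; ring.
have dq1 : q - 1 != 0.
  apply: contraNneq b1 => e.
  have {}e : q = 1 by apply/eqP; rewrite -subr_eq0 e.
  by apply/eqP; rewrite -[RHS]E e; ring.
have dpBq : p - q != 0.
  apply: contraNneq (mulf_neq0 p0 b1) => e.
  have {}e : q = p by apply/eqP; rewrite eq_sym -subr_eq0 e.
  by apply/eqP; rewrite -[RHS]E e; ring.
have dpq : p * q - 1 != 0.
  apply: contraNneq b2 => e.
  have {}e : q = p^-1.
    by apply: (mulfI p0); rewrite mulfV //; apply/eqP; rewrite -subr_eq0 e.
  by apply/eqP; rewrite -[RHS](mul0r (p ^+ 2)) -E e; field.
have dqp2 : q - p ^+ 2 != 0.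
  apply: contraNneq (mulf_neq0 p0 b2) => e.
  have {}e : q = p ^+ 2 by apply/eqP; rewrite -subr_eq0 e.
  by apply/eqP; rewrite -[RHS]E e; ring.
(* The roots of the quadratic are q and p/q, so p = q^2 makes them coincide. Minus the discriminant
   is [B3] at p, a difference of squares that factors once p is q^2. *)
have dpq2 : p - q ^+ 2 != 0.
  apply: contraNneq (mulf_neq0 q0 b3) => e.
  have {}e : p = q ^+ 2 by apply/eqP; rewrite -subr_eq0 e.
  apply/eqP; move: E; rewrite e => E.
  transitivity (((q ^+ 2 + q + q ^+ 2 * q) * (q ^+ 2 + q + 1)
    - 4 * s * q ^+ 2 * q) * (2 * q * (1 + q ^+ 2)
      - (1 + q ^+ 2) ^+ 2 - q ^+ 2 + 4 * s * q ^+ 2)); first by ring.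
  by rewrite E mul0r.
have neqP (x y z : K) : x - y = z -> z != 0 -> x != y.
  by move=> <-; rewrite subr_eq0.
pose h : seq K := [:: p; q; q / p; p^-1; q^-1; p / q].
have uh : uniq h.
  pose nzE := (negPf p0, negPf q0, negPf pN1, negPf p1, negPf dqN1, negPf dq1,
    negPf dpBq, negPf dpDq, negPf dpq, negPf dqp2, negPf dpq2).
  pose zE := (mulf_eq0, invr_eq0, oppr_eq0, nzE).
  (* The fifteen pairwise differences of vertices are factored into quantities known to be
     nonzero. *)
  rewrite /= !inE !negb_or /= !andbT -!andbA.
  apply/andP; split.
    by apply: (neqP _ _ (p - q));
      [field; rewrite ?p0 ?q0 | rewrite !zE].
  apply/andP; split.
    by apply: (neqP _ _ (- (q - p ^+ 2) / p));
      [field; rewrite ?p0 ?q0 | rewrite !zE].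
  apply/andP; split.
    by apply: (neqP _ _ ((p - 1) * (p + 1) / p));
      [field; rewrite ?p0 ?q0 | rewrite !zE].
  apply/andP; split.
    by apply: (neqP _ _ ((p * q - 1) / q));
      [field; rewrite ?p0 ?q0 | rewrite !zE].
  apply/andP; split.
    by apply: (neqP _ _ (p * (q - 1) / q));
      [field; rewrite ?p0 ?q0 | rewrite !zE].
  apply/andP; split.
    by apply: (neqP _ _ (q * (p - 1) / p));
      [field; rewrite ?p0 ?q0 | rewrite !zE].
  apply/andP; split.
    by apply: (neqP _ _ ((p * q - 1) / p));
      [field; rewrite ?p0 ?q0 | rewrite !zE].
  apply/andP; split.
    by apply: (neqP _ _ ((q - 1) * (q + 1) / q));
      [field; rewrite ?p0 ?q0 | rewrite !zE].
  apply/andP; split.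
    by apply: (neqP _ _ (- (p - q ^+ 2) / q));
      [field; rewrite ?p0 ?q0 | rewrite !zE].
  apply/andP; split.
    by apply: (neqP _ _ ((q - 1) / p));
      [field; rewrite ?p0 ?q0 | rewrite !zE].
  apply/andP; split.
    by apply: (neqP _ _ (- (p - q ^+ 2) / (p * q)));
      [field; rewrite ?p0 ?q0 | rewrite !zE].
  apply/andP; split.
    by apply: (neqP _ _ (- ((p - q) * (p + q)) / (p * q)));
      [field; rewrite ?p0 ?q0 | rewrite !zE].
  apply/andP; split.
    by apply: (neqP _ _ (- (p - q) / (p * q)));
      [field; rewrite ?p0 ?q0 | rewrite !zE].
  apply/andP; split.
    by apply: (neqP _ _ ((q - p ^+ 2) / (p * q)));
      [field; rewrite ?p0 ?q0 | rewrite !zE].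
  by apply: (neqP _ _ (- (p - 1) / q));
      [field; rewrite ?p0 ?q0 | rewrite !zE].
have h0 k : (k < 6)%N -> h`_k != 0.
  have : all (fun x => x != 0) h by rewrite /= ?mulf_neq0 ?invr_eq0 ?p0 ?q0.
  by move/(all_nthP 0); apply.
(* The tangency condition of each edge is a Laurent monomial in p and q times that of the first
   edge. *)
have scaleE c x : x = c * ((p + q + p * q) * (p + q + 1) - 4 * s * p * q) ->
  x = 0 by move=> ->; rewrite E mulr0.
exists (fun i => circle_point h`_i); split.
- move=> i j /circle_point_inj /eqP.
  by rewrite nth_uniq // => /eqP; apply: val_inj.
- by move=> i; apply: circle_point_on; apply: h0.
move=> [i lti]; apply: circle_chord_tangent => //; [exact: h0|exact: h0|].
apply/eqP; rewrite -subr_eq0; apply/eqP; rewrite -/s.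
case: i lti => [|[|[|[|[|[|//]]]]]] _ /=.
- by apply: (scaleE (1)); field; rewrite ?p0 ?q0.
- by apply: (scaleE (q / p ^+ 2)); field; rewrite ?p0 ?q0.
- by apply: (scaleE ((p ^+ 3)^-1)); field; rewrite ?p0 ?q0.
- by apply: (scaleE (((p * q) ^+ 2)^-1)); field; rewrite ?p0 ?q0.
- by apply: (scaleE ((q ^+ 3)^-1)); field; rewrite ?p0 ?q0.
- by apply: (scaleE (p / q ^+ 2)); field; rewrite ?p0 ?q0.
Qed.

End CirclePoints.

(** * Complex derivatives, local inverses and nearby roots *)

Section ComplexDerivative.
Variable K : numFieldType.
Implicit Types (f g : K -> K) (p q : {poly K}).

Lemma is_derive_quotient f g (x a b : K) : g x != 0 ->
  is_derive x 1 f a -> is_derive x 1 g b ->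
  is_derive x 1 (fun y => f y / g y) ((a * g x - f x * b) / g x ^+ 2).
Proof.
move=> gx0 df dg.
have dV : is_derive x 1 (fun y => (g y)^-1) (- (g x) ^- 2 *: b).
  apply: DeriveDef; first by apply: derivableV => //; case: dg.
  by rewrite deriveV //; case: dg => _ ->.
apply: (is_derive_eq (is_deriveM df dV)).
rewrite /GRing.scale /=.
by field.
Qed.

Lemma is_derive_horner p g (x b : K) : is_derive x 1 g b ->
  is_derive x 1 (fun y => p.[g y]) (p^`().[g x] * b).
Proof.
move=> dg; elim/poly_ind: p => [|p c IH].
  rewrite deriv0 horner0 mul0r (_ : (fun _ => _) = cst 0).
    exact: is_derive_cst.
  by apply/funext => y; rewrite horner0.
rewrite (_ : (fun _ => _) = (fun y => p.[g y]) * g + cst c); last first.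
  by apply/funext => y; rewrite !hornerE.
apply: is_derive_eq.
by rewrite derivD derivM derivX derivC !hornerE /GRing.scale /=; ring.
Qed.

Lemma is_derive_rational p q g (x b : K) : q.[g x] != 0 -> is_derive x 1 g b ->
  is_derive x 1 (fun y => p.[g y] / q.[g y])
    ((p^`().[g x] * q.[g x] - p.[g x] * q^`().[g x]) / q.[g x] ^+ 2 * b).
Proof.
move=> qx0 dg.
apply: (is_derive_eq (is_derive_quotient _ (is_derive_horner p dg)
  (is_derive_horner q dg))) => //.
by field.
Qed.

(** The difference quotient of [g] is the reciprocal of that of [f] taken at the increment g(h + z)
    - g(z). Continuity of [g] sends this increment to 0. *)
Lemma is_derive_right_inverse f g (z d : K) :
  (\forall w \near z, f (g w) = w) -> {for z, continuous g} ->
  is_derive (g z) 1 f d -> d != 0 -> is_derive z 1 g d^-1.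
Proof.
move=> fgK gC [df dfE] d0.
have fgz : f (g z) = z by exact: nbhs_singleton fgK.
have Sf : k^-1 * (f (k + g z) - f (g z)) @[k --> 0^'] --> d.
  rewrite -dfE; apply: cvg_trans df; apply: near_eq_cvg; near=> k.
  by rewrite /= [k%:A]mulr1.
pose k (h : K) : K := g (h + z) - g z.
have nfg : \forall h \near (0 : K), f (g (h + z)) = h + z.
  by move: fgK; rewrite (near_shift 0) /= subr0.
(* The increment must also avoid 0: if g(h + z) = g(z), applying [f] gives h = 0. *)
have k0 : k h @[h --> 0^'] --> 0^'.
  move=> A A0.
  have ngz : \forall v \near g z, v - g z != 0 -> A (v - g z).
    rewrite (near_shift 0) /= subr0; near=> y; rewrite /= addrK.
    by near: y; exact: A0.
  have : \forall h \near (0 : K), k h != 0 -> A (k h).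
    have : \forall w \near z, g w - g z != 0 -> A (g w - g z) by exact: gC ngz.
    by rewrite (near_shift 0) /= subr0.
  move: nfg; rewrite !near_simpl near_withinE /=.
  apply: filter_app2; near=> h => fgh Ak h0; apply: Ak.
  rewrite /k subr_eq0; apply: contraNneq h0 => gh.
  by rewrite -(addrK z h) -fgh gh fgz subrr.
have Sg : h^-1 *: (g (h%:A + z) - g z) @[h --> 0^'] --> d^-1.
  apply: cvg_trans (cvgV d0 (cvg_comp _ _ k0 Sf)); apply: near_eq_cvg.
  near=> h.
  have fgh : f (g (h + z)) = h + z.
    by near: h; rewrite near_withinE; apply: filterS nfg.
  by rewrite /= [h%:A]mulr1 /k subrK fgz fgh addrK invfM invrK mulrC.
have E : 'D_1 g z = d^-1 by exact: cvg_lim Sg.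
by apply: DeriveDef => //; apply/cvg_ex; exists d^-1.
Unshelve. all: by end_near. Qed.

(** The inverse of an injective open map is continuous. Openness is assumed at all points near [u0]
    because continuity of [g] is wanted at all points near [f u0]. *)
Lemma local_inverse f (u0 : K) :
  (exists2 A, nbhs u0 A & {in A &, injective f}) ->
  (\forall u \near u0, forall A, nbhs u A -> nbhs (f u) (f @` A)) ->
  exists g : K -> K,
    (\forall u \near u0, g (f u) = u) /\
    (\forall z \near f u0, f (g z) = z /\ {for z, continuous g}).
Proof.
move=> [A nA injA] openf.
pose g z := xget u0 [set v | A v /\ f v = z].
have gE v z : A v -> f v = z -> g z = v.
  move=> Av fv; have [Ag fg] := xgetI u0 (conj Av fv : [set v | _ /\ _] v).
  by apply: injA; rewrite ?inE // fv.
exists g; split; first by apply: filterS nA => u Au; exact: gE.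
(* At points of [B] both hypotheses are usable, and openness at [u0] makes f(B) a neighbourhood of
   [f u0]. *)
pose B := [set u | nbhs u A /\ forall C, nbhs u C -> nbhs (f u) (f @` C)].
have nB : nbhs u0 B by apply: filterI openf; exact: nbhs_interior.
have nfB : nbhs (f u0) (f @` B) by case: (nbhs_singleton nB) => _; apply.
apply: filterS nfB => z [u [uA uo] <-{z}].
have gfu : g (f u) = u by apply: gE => //; exact: nbhs_singleton.
split; first by rewrite gfu.
move=> C; rewrite gfu => uC.
apply: filterS (uo _ (filterI uA uC)) => w [v [Av Cv] fv] /=.
by rewrite (gE v).
Qed.

End ComplexDerivative.

(** |p(u)| is the product of the distances from u to the roots; were they all at least e, it would
    be at least e to the degree. *)
Lemma exists_root_near (K : numClosedFieldType) (p : {poly K}) (u e : K) :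
  p \is monic -> 0 < e -> `|p.[u]| < e ^+ (size p).-1 ->
  exists2 v, root p v & `|u - v| < e.
Proof.
move=> mp e0; have [rs pE] := closed_field_poly_normal p.
move: pE; rewrite (monicP mp) scale1r => pE.
rewrite pE size_prod_XsubC /= horner_prod => lt_e.
have [/hasP[v vrs lt_v]|] := boolP (has (fun v => `|u - v| < e) rs).
  by exists v => //; rewrite root_prod_XsubC.
rewrite -all_predC => /allP ge_e.
have: e ^+ size rs <= `|\prod_(i <- rs) ('X - i%:P).[u]|.
  elim: (rs) ge_e => [|v s IH] ge_e; first by rewrite big_nil normr1.
  rewrite /= big_cons normrM exprS.
  apply: ler_pM; [exact: ltW | exact/exprn_ge0/ltW | |].
    rewrite !hornerE /= (real_leNgt (gtr0_real e0) (normr_real _)).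
    exact: (ge_e v (mem_head _ _)).
  by apply: IH => w ws; apply: ge_e; rewrite inE ws orbT.
by move=> /(lt_le_trans lt_e); rewrite ltxx.
Qed.

(** * The determinant of the pencil spanned by the circle and a confocal conic *)

Lemma det_mx22 (R : comPzRingType) (A : 'M[R]_2) :
  \det A = A 0 0 * A 1 1 - A 0 1 * A 1 0.
Proof.
have l00 : lift (0 : 'I_2) (0 : 'I_1) = 1 by exact: val_inj.
have l10 : lift (1 : 'I_2) (0 : 'I_1) = 0 by exact: val_inj.
rewrite (expand_det_row _ 0) big_ord_recl big_ord1 l00 /cofactor !det_mx11 !mxE.
by rewrite l00 l10 /= expr0 expr1 mul1r mulN1r mulrN.
Qed.

Lemma det_mx33 (R : comPzRingType) (A : 'M[R]_3) :
  \det A = A 0 0 * (A 1 1 * A 2%:R 2%:R - A 1 2%:R * A 2%:R 1)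
         - A 0 1 * (A 1 0 * A 2%:R 2%:R - A 1 2%:R * A 2%:R 0)
         + A 0 2%:R * (A 1 0 * A 2%:R 1 - A 1 1 * A 2%:R 0).
Proof.
have l00 : lift (0 : 'I_3) (0 : 'I_2) = 1 by exact: val_inj.
have l01 : lift (0 : 'I_3) (1 : 'I_2) = 2%:R by exact: val_inj.
have l10 : lift (1 : 'I_3) (0 : 'I_2) = 0 by exact: val_inj.
have l11 : lift (1 : 'I_3) (1 : 'I_2) = 2%:R by exact: val_inj.
have l20 : lift (2%:R : 'I_3) (0 : 'I_2) = 0 by exact: val_inj.
have l21 : lift (2%:R : 'I_3) (1 : 'I_2) = 1 by exact: val_inj.
rewrite (expand_det_row _ 0) sum_ord3 /cofactor !det_mx22 !mxE.
rewrite l00 l01 l10 l11 l20 l21 /= expr0 expr1 mul1r mulN1r mulrN.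
by rewrite sqrrN expr1n mul1r.
Qed.

Lemma cubic_det (K : numFieldType) (a t la : K) :
  a - t != 0 -> a - t - 4^-1 != 0 ->
  cubic (a - t) la =
  (a - t) * (a - t - 4^-1) * \det (confocal a t + la *: Gamma0 K).
Proof.
move=> s0 s14; rewrite det_mx33 /confocal !mxE /= ?mulr1n ?mulr0n.
set s := a - t in s0 s14 *.
have d14 : s * 4 - 1 != 0.
  have -> : s * 4 - 1 = 4 * (s - 4^-1) by field.
  by rewrite mulf_neq0 ?pnatr_eq0.
by rewrite /cubic; field; rewrite s0 d14.
Qed.

(** * The rational parametrization by u, its local inversion and the Painleve identity *)

Section Curve.
Variable K : numFieldType.
Implicit Types (u s : K) (p : {poly K}).

Lemma horner_near_neq0 p u : p.[u] != 0 -> \forall v \near u, p.[v] != 0.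
Proof.
suff pC : {for u, continuous (horner p)} by exact: cvgr_neq0 pC.
elim/poly_ind: p => [|p c IH].
  rewrite (_ : horner 0 = cst 0); first exact: cst_continuous.
  by apply/funext => y; rewrite horner0.
rewrite (_ : horner _ = (horner p \* id) \+ cst c); last first.
  by apply/funext => y; rewrite !hornerE.
apply: continuousD; last exact: cst_continuous.
exact: continuousM.
Qed.

Definition curve_x u : K := u ^+ 3 * (u + 2) / (2 * u + 1).
Definition curve_y u : K := u * (u ^+ 2 + u + 1) / (2 * u + 1).
Definition curve_y0 u : K := - (u * (u + 2)).

(** This one is a derivative in u; the next three are derivatives in x (dy/dx, its x-derivative, and
    dy_0/dx) written in terms of u. *)
Definition curve_dx u : K := 6 * u ^+ 2 * (u + 1) ^+ 2 / (2 * u + 1) ^+ 2.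
Definition curve_dy u : K := (4 * u ^+ 2 + u + 1) / (6 * u ^+ 2 * (u + 1)).
Definition curve_ddy u : K :=
  - ((2 * u + 1) ^+ 3 * (u ^+ 2 + 1)) / (18 * u ^+ 5 * (u + 1) ^+ 4).
Definition curve_dy0 u : K := - (2 * u + 1) ^+ 2 / (3 * u ^+ 2 * (u + 1)).

Lemma is_derive_curve_x u : 2 * u + 1 != 0 ->
  is_derive u 1 curve_x (curve_dx u).
Proof.
move=> u12.
pose P : {poly K} := 'X^3 * ('X + 2%:P); pose Q : {poly K} := 2%:P * 'X + 1.
have -> : curve_x = fun v => P.[id v] / Q.[id v].
  by apply/funext => v; rewrite /curve_x !hornerE.
have Q0 : Q.[id u] != 0 by rewrite !hornerE.
apply: (is_derive_eq (is_derive_rational P Q0 (is_derive_id u 1))).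
rewrite /curve_dx /P /Q !poly.derivE !hornerE /=.
by field.
Qed.

Section Reparametrized.
Variables (g : K -> K) (z : K).
Hypotheses (gz12 : 2 * g z + 1 != 0) (gz0 : g z != 0) (gz1 : g z + 1 != 0).
Hypothesis dg : is_derive z 1 g (curve_dx (g z))^-1.

(** Here [g] stands for u as a function of x, so this is (dy/du)/(dx/du). *)
Lemma is_derive_curve_y : is_derive z 1 (curve_y \o g) (curve_dy (g z)).
Proof.
pose P : {poly K} := 'X * ('X^2 + 'X + 1); pose Q : {poly K} := 2%:P * 'X + 1.
have -> : curve_y \o g = fun v => P.[g v] / Q.[g v].
  by apply/funext => v; rewrite /= /curve_y !hornerE.
have Q0 : Q.[g z] != 0 by rewrite !hornerE.
apply: (is_derive_eq (is_derive_rational P Q0 dg)).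
rewrite /curve_dx /curve_dy /P /Q !poly.derivE !hornerE /=.
by field; rewrite gz0 gz1 gz12.
Qed.

Lemma is_derive_curve_dy : is_derive z 1 (curve_dy \o g) (curve_ddy (g z)).
Proof.
pose P : {poly K} := 4%:P * 'X^2 + 'X + 1.
pose Q : {poly K} := 6%:P * 'X^2 * ('X + 1).
have -> : curve_dy \o g = fun v => P.[g v] / Q.[g v].
  by apply/funext => v; rewrite /= /curve_dy !hornerE.
have Q0 : Q.[g z] != 0.
  by rewrite !hornerE /= !mulf_neq0 ?expf_neq0 ?pnatr_eq0.
apply: (is_derive_eq (is_derive_rational P Q0 dg)).
rewrite /curve_dx /curve_ddy /P /Q !poly.derivE !hornerE /=.
by field; rewrite gz0 gz1 gz12.
Qed.

Lemma is_derive_curve_y0 : is_derive z 1 (curve_y0 \o g) (curve_dy0 (g z)).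
Proof.
pose P : {poly K} := - ('X * ('X + 2%:P)).
have -> : curve_y0 \o g = fun v => P.[g v].
  by apply/funext => v; rewrite /= /curve_y0 !hornerE.
apply: (is_derive_eq (is_derive_horner P dg)).
rewrite /curve_dx /curve_dy0 /P !poly.derivE !hornerE /=.
by field; rewrite gz0 gz1 gz12.
Qed.

End Reparametrized.

(** [Q] is a divided difference: (x(v) - x(w)) (2 v + 1) (2 w + 1) = (v - w) Q(v, w). On the
    diagonal it is the numerator of dx/du, so it stays nonzero near (u, u). *)
Lemma curve_x_locally_injective u : u != 0 -> u + 1 != 0 -> 2 * u + 1 != 0 ->
  exists2 A, nbhs u A & {in A &, injective curve_x}.
Proof.
move=> u0 u1 u12.
pose Q (v w : K) : K := (v + w) * (v * v + w * w)
  + 2 * (1 + v * w) * (v * v + v * w + w * w) + 4 * (v * w) * (v + w).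
have QC : {for (u, u), continuous (fun p : K * K => Q p.1 p.2)}.
  pose C (F : K * K -> K) := {for (u, u), continuous F}.
  have cD F G : C F -> C G -> C (fun xy => F xy + G xy) by exact: continuousD.
  have cM F G : C F -> C G -> C (fun xy => F xy * G xy) by exact: continuousM.
  have c1 : C fst by exact: cvg_fst.
  have c2 : C snd by exact: cvg_snd.
  have cc c : C (cst c) by exact: cvg_cst.
  have vw := cM _ _ c1 c2; have vv := cM _ _ c1 c1; have ww := cM _ _ c2 c2.
  have sum := cD _ _ c1 c2.
  have t1 := cM _ _ sum (cD _ _ vv ww).
  have t2 :=
    cM _ _ (cM _ _ (cc 2) (cD _ _ (cc 1) vw)) (cD _ _ (cD _ _ vv vw) ww).
  have t3 := cM _ _ (cM _ _ (cc 4) vw) sum.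
  exact: cD _ _ (cD _ _ t1 t2) t3.
have Q0 : Q u u != 0.
  have -> : Q u u = 6 * u ^+ 2 * (u + 1) ^+ 2 by rewrite /Q; ring.
  by rewrite !mulf_neq0 ?expf_neq0 ?pnatr_eq0.
have : \forall p \near (u, u), Q p.1 p.2 != 0 by exact: cvgr_neq0 QC Q0.
case=> -[B C] [/= nB nC] BC.
have nD : \forall v \near u, 2 * v + 1 != 0.
  have := @horner_near_neq0 (2%:P * 'X + 1) u; rewrite !hornerE => /(_ u12).
  by apply: filterS => v; rewrite !hornerE.
exists (B `&` C `&` [set v | 2 * v + 1 != 0]).
  by do 2 apply: filterI => //.
move=> v w; rewrite !inE /= => -[[Bv _] v12] [[_ Cw] w12] e.
apply/eqP; rewrite -subr_eq0.
have : (v - w) * Q v w == 0.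
  rewrite (_ : _ * _ = (curve_x v - curve_x w) * (2 * v + 1) * (2 * w + 1)).
    by rewrite e subrr !mul0r.
  by rewrite /Q /curve_x; field; rewrite v12 w12.
by rewrite mulf_eq0 (negPf (BC (v, w) (conj Bv Cw))) orbF.
Qed.

End Curve.

Lemma curve_x_open (K : numClosedFieldType) (u : K) : 2 * u + 1 != 0 ->
  forall A, nbhs u A -> nbhs (curve_x u) (@curve_x K @` A).
Proof.
move=> u12 A /nbhs_ballP[e /= e0 eA].
(* The quartic [p] below takes the value (x(u) - z) (2 u + 1) at u; this radius makes it smaller
   than e^4. *)
apply/nbhs_ballP; exists (e ^+ 4 / `|2 * u + 1|) => /=.
  by rewrite divr_gt0 ?exprn_gt0 ?normr_gt0.
move=> z; rewrite /ball /= ltr_pdivlMr ?normr_gt0 // => uz.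
pose p := Poly [:: - z; - 2 * z; 0; 2; 1].
have pE : p = [:: - z; - 2 * z; 0; 2; 1] :> seq K.
  by apply: (@PolyK _ 1); rewrite /= oner_neq0.
have phE v : p.[v] = v ^+ 3 * (v + 2) - z * (2 * v + 1).
  by rewrite horner_Poly /=; ring.
have [|||v] := @exists_root_near _ p u e.
- by rewrite monicE lead_coefE pE.
- by [].
- rewrite pE /= phE (_ : _ - _ = (curve_x u - z) * (2 * u + 1)) ?normrM //.
  by rewrite /curve_x; field.
rewrite /root phE => /eqP pv uv.
(* At v = -1/2 the quartic equals v^3 (v + 2) = -3/16, whatever z is. *)
have v12 : 2 * v + 1 != 0.
  apply/eqP => v12; move: pv; rewrite v12 mulr0 subr0.
  have -> : v = - 2^-1.
    apply: (mulfI (_ : 2 != 0)); rewrite ?pnatr_eq0 //.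
    by apply/eqP; rewrite mulrN mulfV ?pnatr_eq0 // -addr_eq0 v12.
  move/eqP; rewrite mulf_eq0 expf_eq0 oppr_eq0 invr_eq0 pnatr_eq0 /=.
  have -> : - 2^-1 + 2 = 3 / 2 :> K by field.
  by rewrite mulf_eq0 invr_eq0 !pnatr_eq0.
exists v; first by apply: eA.
rewrite /curve_x; apply: (canLR (mulfK v12)).
by apply/eqP; rewrite -subr_eq0 pv.
Qed.

Lemma curve_x_local_inverse (K : numClosedFieldType) (u : K) :
  u != 0 -> u + 1 != 0 -> 2 * u + 1 != 0 ->
  exists g : K -> K, [/\ g (curve_x u) = u, {for curve_x u, continuous g},
    \forall v \near u, g (curve_x v) = v &
    \forall z \near curve_x u, curve_x (g z) = z /\
      is_derive z 1 g (curve_dx (g z))^-1].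
Proof.
move=> u0 u1 u12.
(* The roots of [W] are the critical points 0 and -1 and the pole -1/2 of x(u). *)
pose W : {poly K} := 'X * ('X + 1) * (2%:P * 'X + 1).
have WE v : (W.[v] != 0) = [&& v != 0, v + 1 != 0 & 2 * v + 1 != 0].
  by rewrite !hornerE /= !mulf_eq0 !negb_or -andbA.
have nW : \forall v \near u, W.[v] != 0.
  by apply: horner_near_neq0; rewrite WE u0 u1.
have openx : \forall v \near u, forall A, nbhs v A ->
    nbhs (curve_x v) (@curve_x K @` A).
  by apply: filterS nW => v; rewrite WE => /and3P[_ _]; exact: curve_x_open.
have [g [gK xgK]] := local_inverse (curve_x_locally_injective u0 u1 u12) openx.
have gu : g (curve_x u) = u := nbhs_singleton gK.
have gC : {for curve_x u, continuous g} by have [] := nbhs_singleton xgK.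
exists g; split => //.
have nWg : \forall z \near curve_x u, W.[g z] != 0.
  have : \forall v \near g (curve_x u), W.[v] != 0 by rewrite gu.
  exact: gC.
(* Differentiating [g] at z uses x(g(w)) = w on a whole neighbourhood of z, hence the passage to the
   interior. *)
have ixgK := nbhs_interior xgK.
near=> z.
have /and3P[gz0 gz1 gz12] : [&& g z != 0, g z + 1 != 0 & 2 * g z + 1 != 0].
  by rewrite -WE; near: z; exact: nWg.
have [xgz gCz] : curve_x (g z) = z /\ {for z, continuous g}.
  by near: z; exact: xgK.
split => //.
apply: (@is_derive_right_inverse _ (@curve_x K)) => //.
- have : interior [set z | curve_x (g z) = z /\ {for z, continuous g}] z.
    by near: z; exact: ixgK.
  by apply: filterS => w [].
- exact: is_derive_curve_x.
by rewrite /curve_dx !mulf_neq0 ?invr_eq0 ?expf_neq0 ?pnatr_eq0.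
Unshelve. all: by end_near. Qed.

(** The excluded u are those where x is 0, 1 or infinite, or where y = 0. Factoring x - 1, y - 1 and
    y - x first leaves only these factors in the denominators. *)
Lemma curve_painleve6 (K : numFieldType) (u : K) :
  u != 0 -> u + 1 != 0 -> u - 1 != 0 -> u + 2 != 0 -> 2 * u + 1 != 0 ->
  u ^+ 2 + u + 1 != 0 ->
  curve_ddy u = painleve6_rhs (1 / 8) (- (1 / 8)) (1 / 8) (3 / 8)
    (curve_x u) (curve_y u) (curve_dy u).
Proof.
move=> u0 u1 uN1 u2 u12 u3.
have x1 : curve_x u - 1 = (u + 1) ^+ 3 * (u - 1) / (2 * u + 1).
  by rewrite /curve_x; field.
have y1 : curve_y u - 1 = (u + 1) ^+ 2 * (u - 1) / (2 * u + 1).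
  by rewrite /curve_y; field.
have yx : curve_y u - curve_x u = - (u * (u - 1) * (u + 1) ^+ 2) / (2 * u + 1).
  by rewrite /curve_x /curve_y; field.
rewrite /painleve6_rhs x1 y1 yx /curve_x /curve_y /curve_dy /curve_ddy.
field.
by rewrite u0 u1 uN1 u2 u12 u3.
Qed.

(** * The parameter u attached to a branch of the square root *)

Section Branch.
Variables (K : numFieldType) (U : set K) (r : K -> K).
Hypothesis hr : sqrt_branch U r.

(* 16 s^2 - 40 s + 9 = (4 s - 5)^2 - 16, so the conic is parametrized by
   4 s - 5 = 2 (u + 1/u), r = 2 (u - 1/u). *)
Definition branch_param (s : K) : K := (4 * s - 5 + r s) / 4.

(** The conjugate (4 s - 5 - r)/4 is 1/u, because ((4 s - 5)^2 - r^2)/16 = 1; the sum and the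
    difference of u and 1/u then give s and r. *)
Lemma branch_paramP s : U s -> let u := branch_param s in
  [/\ u != 0, s = (2 * u + 1) * (u + 2) / (4 * u)
    & r s = 2 * (u ^+ 2 - 1) / u].
Proof.
case: hr => _ _ rE Us u.
have uV : u * ((4 * s - 5 - r s) / 4) = 1.
  have -> : u * ((4 * s - 5 - r s) / 4) = ((4 * s - 5) ^+ 2 - r s ^+ 2) / 16.
    by rewrite /u /branch_param; field.
  by rewrite rE //; field.
have u0 : u != 0.
  by apply: contra_eq_neq uV => ->; rewrite mul0r eq_sym oner_eq0.
have uVE : u^-1 = (4 * s - 5 - r s) / 4 by apply: (mulfI u0); rewrite mulfV.
split => //.
  have -> : (2 * u + 1) * (u + 2) / (4 * u) = (5 + 2 * (u + u^-1)) / 4.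
    by field; rewrite u0.
  by rewrite uVE /u /branch_param; field.
have -> : 2 * (u ^+ 2 - 1) / u = 2 * (u - u^-1) by field.
by rewrite uVE /u /branch_param; field.
Qed.

Lemma branch_param_continuous s : U s -> {for s, continuous branch_param}.
Proof.
case: hr => _ dr _ Us.
have rC : {for s, continuous r}.
  by apply: differentiable_continuous; apply/derivable1_diffP; exact: dr.
apply: continuousM; last exact: cst_continuous.
apply: continuousD => //; apply: continuousD; last exact: cst_continuous.
by apply: continuousM; [exact: cst_continuous | exact: cvg_id].
Qed.

Lemma near_branch_param (p : {poly K}) s : U s -> p.[branch_param s] != 0 ->
  \forall t \near s, U t /\ p.[branch_param t] != 0.
Proof.
move=> Us ps; apply: filterI.
  by case: hr => oU _ _; exact: open_nbhs_nbhs.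
exact: branch_param_continuous Us _ (horner_near_neq0 ps).
Qed.

Section AtPoint.
Variable s : K.
Hypothesis Us : U s.
Let u := branch_param s.

Lemma den6E : den6 r s = - (8 * (2 * u + 1)) / u ^+ 2.
Proof.
have [u0 sE rE] := branch_paramP Us; rewrite -/u in u0 sE rE.
by rewrite /den6 rE sE; field; rewrite u0.
Qed.

Lemma x6E : 2 * u + 1 != 0 -> x6 r s = curve_x u.
Proof.
move=> u12; have [u0 sE rE] := branch_paramP Us; rewrite -/u in u0 sE rE.
by rewrite /x6 den6E /curve_x rE sE; field; rewrite u0 u12.
Qed.

Lemma y6E : 2 * u + 1 != 0 -> y6 r s = curve_y u.
Proof.
move=> u12; have [u0 sE rE] := branch_paramP Us; rewrite -/u in u0 sE rE.
by rewrite /y6 den6E /curve_y sE; field; rewrite u0 u12.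
Qed.

Lemma lambda1E : u + 1 != 0 -> lambda1 s = - (2 * u) / (u + 1) ^+ 2.
Proof.
move=> u1; have [u0 sE rE] := branch_paramP Us; rewrite -/u in u0 sE rE.
have E : 4 * s - 1 = 2 * (u + 1) ^+ 2 / u by rewrite sE; field; rewrite u0.
by rewrite /lambda1 E; field; rewrite u0 u1.
Qed.

Lemma lambda2E : u + 2 != 0 -> 2 * u + 1 != 0 -> lambda2 r s = - 2 / (u + 2).
Proof.
move=> u2 u12; have [u0 sE rE] := branch_paramP Us; rewrite -/u in u0 sE rE.
have E : 8 * s = 2 * (2 * u + 1) * (u + 2) / u by rewrite sE; field; rewrite u0.
by rewrite /lambda2 E rE; field; rewrite u0 u12 u2.
Qed.

Lemma lambda3E :
  u + 2 != 0 -> 2 * u + 1 != 0 -> lambda3 r s = - (2 * u) / (2 * u + 1).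
Proof.
move=> u2 u12; have [u0 sE rE] := branch_paramP Us; rewrite -/u in u0 sE rE.
have E : 8 * s = 2 * (2 * u + 1) * (u + 2) / u by rewrite sE; field; rewrite u0.
by rewrite /lambda3 E rE; field; rewrite u0 u12 u2.
Qed.

Lemma lambda12E : u + 1 != 0 -> u + 2 != 0 -> 2 * u + 1 != 0 ->
  lambda1 s - lambda2 r s = 2 / ((u + 1) ^+ 2 * (u + 2)).
Proof.
move=> u1 u2 u12.
by rewrite lambda1E // lambda2E //; field; rewrite u1 u2.
Qed.

Lemma y0_curveE : u + 1 != 0 -> u + 2 != 0 -> 2 * u + 1 != 0 ->
  y0 r s = curve_y0 u.
Proof.
move=> u1 u2 u12; rewrite /y0 lambda12E // lambda1E // /curve_y0.
by field; rewrite u1 u2.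
Qed.

(** The factor 2 u + 1 divides the denominator, u + 2 divides x, and u + 1 and u - 1 divide x -
    1. *)
Lemma branch_param_neq0 : den6 r s != 0 -> x6 r s != 0 -> x6 r s != 1 ->
  [/\ u != 0, u + 1 != 0, u - 1 != 0, u + 2 != 0 & 2 * u + 1 != 0].
Proof.
have [u0 _ _] := branch_paramP Us; rewrite -/u in u0.
rewrite den6E mulf_eq0 oppr_eq0 mulf_eq0 !negb_or -andbA => /and3P[_ u12 _].
rewrite x6E // -(subr_eq0 _ 1).
have -> : curve_x u - 1 = (u + 1) ^+ 3 * (u - 1) / (2 * u + 1).
  by rewrite /curve_x; field.
move=> x0 x1; split=> //.
- by apply: contraNneq x1 => ->; rewrite expr0n !mul0r.
- by apply: contraNneq x1 => ->; rewrite mulr0 mul0r.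
- by apply: contraNneq x0 => e; rewrite /curve_x e mulr0 mul0r.
Qed.

(** The factors of [lambda2] and [lambda3] multiply to a difference of squares in which only r^2
    occurs, so the radicand can be substituted. *)
Lemma cubic_roots la : s != 0 -> 4 * s - 1 != 0 ->
  cubic s la = - (4^-1) * s * (4 * s - 1)
    * (la - lambda1 s) * (la - lambda2 r s) * (la - lambda3 r s).
Proof.
move=> s0 s14; case: hr => _ _ rE.
have -> : - (4^-1) * s * (4 * s - 1)
    * (la - lambda1 s) * (la - lambda2 r s) * (la - lambda3 r s) =
  - (4^-1) * s * ((4 * s - 1) * la + 4)
    * ((la + 2^-1 + 3 / (8 * s)) ^+ 2 - r s ^+ 2 / (8 * s) ^+ 2).
  by rewrite /lambda1 /lambda2 /lambda3; field; rewrite s0 s14.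
by rewrite rE // /cubic; field.
Qed.

End AtPoint.
End Branch.

(** * The Painleve solution and the Okamoto transformation near a base point *)

Section ClosedBranch.
Variables (K : numClosedFieldType) (U : set K) (r : K -> K).
Hypothesis hr : sqrt_branch U r.
Variable s0 : K.
Hypotheses (Us0 : U s0) (den0 : den6 r s0 != 0).
Hypotheses (x0 : x6 r s0 != 0) (x1 : x6 r s0 != 1).

(** This makes u a holomorphic function [g] of x along the given branch; y and y_0 become functions
    of x by composition with [g]. *)
Lemma x6_local_inverse : exists g : K -> K,
  [/\ g (x6 r s0) = branch_param r s0, {for x6 r s0, continuous g},
    \forall s \near s0, g (x6 r s) = branch_param r s
  & \forall z \near x6 r s0, curve_x (g z) = z /\
      is_derive z 1 g (curve_dx (g z))^-1].
Proof.
have [u0 u1 uN1 u2 u12] := branch_param_neq0 hr Us0 den0 x0 x1.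
have [g [gu gC gK xgK]] := curve_x_local_inverse u0 u1 u12.
exists g; rewrite (x6E hr Us0 u12); split => //.
pose W : {poly K} := 2%:P * 'X + 1.
have WE v : W.[v] = 2 * v + 1 by rewrite !hornerE.
have W0 : W.[branch_param r s0] != 0 by rewrite WE.
have nK : \forall s \near s0, g (curve_x (branch_param r s)) = branch_param r s.
  have pC := branch_param_continuous hr Us0.
  by apply: (pC [set v | g (curve_x v) = v]).
apply: filterS2 (near_branch_param hr Us0 W0) nK => s [Us].
by rewrite WE => s12; rewrite (x6E hr Us s12).
Qed.

Lemma painleve6_solution :
  y6 r s0 != 0 -> exists f : K -> K,
    locally_function_of (x6 r) (y6 r) s0 f /\
    \forall z \near x6 r s0,
      solves_painleve6_at (1 / 8) (- (1 / 8)) (1 / 8) (3 / 8) f z.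
Proof.
move=> y60.
have [u0 u1 uN1 u2 u12] := branch_param_neq0 hr Us0 den0 x0 x1.
(* This is the only factor of y not yet known to be nonzero. *)
have u3 : branch_param r s0 ^+ 2 + branch_param r s0 + 1 != 0.
  apply: contraNneq y60 => e.
  by rewrite (y6E hr Us0 u12) /curve_y e mulr0 mul0r.
have [g [gu gC gK xgK]] := x6_local_inverse.
pose W : {poly K} := 'X * ('X + 1) * ('X - 1) * ('X + 2%:P)
  * (2%:P * 'X + 1) * ('X^2 + 'X + 1).
have WE v : (W.[v] != 0) = [&& v != 0, v + 1 != 0, v - 1 != 0, v + 2 != 0,
    2 * v + 1 != 0 & v ^+ 2 + v + 1 != 0].
  by rewrite /W !hornerM !mulf_eq0 !negb_or !hornerE /= -!andbA.
have W0 : W.[branch_param r s0] != 0 by rewrite WE u0 u1 uN1 u2 u12.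
have nW : \forall z \near x6 r s0, W.[g z] != 0.
  by apply: (gC [set v | W.[v] != 0]); rewrite gu; exact: horner_near_neq0.
have dy : \forall z \near x6 r s0,
    is_derive (z : K) 1 (@curve_y K \o g) (curve_dy (g z)).
  apply: filterS2 nW xgK => z.
  rewrite WE => /and5P[z0 z1 _ _ /andP[z12 _]] [_ dg].
  exact: is_derive_curve_y.
exists (@curve_y K \o g); split.
  split; first by apply: filterS dy => z [].
  apply: filterS2 (near_branch_param hr Us0 W0) gK => s [Us].
  by rewrite WE => /and5P[_ _ _ _ /andP[s12 _]] /= ->; rewrite (y6E hr Us s12).
(* The second derivative at z needs the formula for the first one on a neighbourhood of z. *)
have ndy := nbhs_interior dy.
apply: filterS3 nW xgK ndy => z; rewrite WE.
move=> /and5P[z0 z1 zN1 z2 /andP[z12 z3]] [xgz dg] dyz.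
have d1 := nbhs_singleton dyz.
have d2 : is_derive z 1 (derive1 (@curve_y K \o g)) (curve_ddy (g z)).
  apply: near_eq_is_derive (is_derive_curve_dy z12 z0 z1 dg).
  by apply: filterS dyz => w [_ dw]; rewrite derive1E dw.
have z0' : z != 0.
  by rewrite -xgz /curve_x !mulf_neq0 ?invr_eq0 ?expf_neq0.
split.
- split => //=.
  + rewrite -subr_eq0 -xgz.
    have -> : curve_x (g z) - 1 =
        (g z + 1) ^+ 3 * (g z - 1) / (2 * g z + 1).
      by rewrite /curve_x; field.
    by rewrite !mulf_neq0 ?invr_eq0 ?expf_neq0.
  + by rewrite /curve_y !mulf_neq0 ?invr_eq0.
  + rewrite -subr_eq0.
    have -> : curve_y (g z) - 1 =
        (g z + 1) ^+ 2 * (g z - 1) / (2 * g z + 1).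
      by rewrite /curve_y; field.
    by rewrite !mulf_neq0 ?invr_eq0 ?expf_neq0.
  + rewrite -{2}xgz -subr_eq0.
    have -> : curve_y (g z) - curve_x (g z) =
        - (g z * (g z - 1) * (g z + 1) ^+ 2) / (2 * g z + 1).
      by rewrite /curve_x /curve_y; field.
    by rewrite !mulf_neq0 ?oppr_eq0 ?invr_eq0 ?mulf_neq0 ?expf_neq0.
- by case: d1.
- by case: d2.
case: d1 d2 => _ d1 [_ d2].
by rewrite derive1E d2 derive1E d1 /= -{2}xgz curve_painleve6.
Qed.

Lemma okamoto_solution :
  [/\ lambda1 s0 != lambda2 r s0,
      x6 r s0 = (lambda3 r s0 - lambda1 s0) / (lambda2 r s0 - lambda1 s0),
      y0 r s0 = 32 * s0 / den6 r s0
    & exists f0 : K -> K,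
      [/\ locally_function_of (x6 r) (y0 r) s0 f0,
          okamoto_den (x6 r s0) (y0 r s0) (derive1 f0 (x6 r s0)) != 0
        & y6 r s0 = okamoto (x6 r s0) (y0 r s0) (derive1 f0 (x6 r s0))]].
Proof.
have [u0 u1 uN1 u2 u12] := branch_param_neq0 hr Us0 den0 x0 x1.
have [g [gu gC gK xgK]] := x6_local_inverse.
have [_ sE _] := branch_paramP hr Us0.
have xE := x6E hr Us0 u12; have yE := y6E hr Us0 u12.
have y0c := y0_curveE hr Us0 u1 u2 u12.
set u := branch_param r s0 in u0 u1 uN1 u2 u12 gu sE xE yE y0c.
split.
- rewrite -subr_eq0 (lambda12E hr Us0) //.
  by rewrite !mulf_neq0 ?invr_eq0 ?mulf_neq0 ?expf_neq0 ?pnatr_eq0.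
- rewrite xE -(opprB _ (lambda2 r s0)) (lambda12E hr Us0) //.
  rewrite (lambda3E hr Us0) // (lambda1E hr Us0) // -/u /curve_x.
  by field; rewrite u1 u2 u12.
- rewrite y0c (den6E hr Us0) -/u sE /curve_y0.
  by field; rewrite u0 u12.
pose W : {poly K} := 'X * ('X + 1) * ('X + 2%:P) * (2%:P * 'X + 1).
have WE v : (W.[v] != 0) =
    [&& v != 0, v + 1 != 0, v + 2 != 0 & 2 * v + 1 != 0].
  by rewrite /W !hornerM !mulf_eq0 !negb_or !hornerE /= -!andbA.
have W0 : W.[u] != 0 by rewrite WE u0 u1 u2.
have nW : \forall z \near x6 r s0, W.[g z] != 0.
  by apply: (gC [set v | W.[v] != 0]); rewrite gu; exact: horner_near_neq0.
have dy0 : \forall z \near x6 r s0,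
    is_derive (z : K) 1 (@curve_y0 K \o g) (curve_dy0 (g z)).
  apply: filterS2 nW xgK => z; rewrite WE => /and4P[z0 z1 _ z12] [_ dg].
  exact: is_derive_curve_y0.
exists (@curve_y0 K \o g).
have [_ d0] := nbhs_singleton dy0.
rewrite gu in d0.
(* The Okamoto denominator factors into powers of u, u + 1 and u + 2, all nonzero here. *)
have okamoto_denE : okamoto_den (curve_x u) (curve_y0 u) (curve_dy0 u) =
    - (u * (u + 2) ^+ 2 * (u + 1) ^+ 2) / 3.
  rewrite /okamoto_den /curve_x /curve_y0 /curve_dy0.
  by field; rewrite u0 u1 u12.
split.
- split; first by apply: filterS dy0 => z [].
  apply: filterS2 (near_branch_param hr Us0 W0) gK => s [Us].
  by rewrite WE => /and4P[_ s1 s2 s12] /= ->; rewrite (y0_curveE hr Us).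
- rewrite derive1E d0 xE y0c okamoto_denE.
  rewrite mulf_neq0 ?oppr_eq0 ?invr_eq0 ?pnatr_eq0 //.
  exact: mulf_neq0 (mulf_neq0 u0 (expf_neq0 2 u2)) (expf_neq0 2 u1).
rewrite derive1E d0 xE y0c yE /okamoto okamoto_denE /curve_y /curve_y0 /curve_x.
by field; rewrite u0 u1 u2 u12.
Qed.

End ClosedBranch.

Theorem theorem6p7 (R : realType) (U : set (Cplx R)) (r : Cplx R -> Cplx R)
    (hr : sqrt_branch U r) :
  (* y as a function of x solves Painleve VI *)
  (forall s0 : Cplx R, U s0 -> den6 r s0 != 0 -> derive1 (x6 r) s0 != 0 ->
     x6 r s0 != 0 -> x6 r s0 != 1 ->
     y6 r s0 != 0 -> y6 r s0 != 1 -> y6 r s0 != x6 r s0 ->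
     exists f : Cplx R -> Cplx R,
       locally_function_of (x6 r) (y6 r) s0 f /\
       \forall z \near x6 r s0,
         solves_painleve6_at (1 / 8) (- (1 / 8)) (1 / 8) (3 / 8) f z) /\
  (* Gamma0 and the confocal conics form a 6-Poncelet inscribed family *)
  (forall a t : Cplx R, a - t != 0 -> a - t - 4^-1 != 0 ->
     (exists P : 'I_6 -> Cplx R * Cplx R,
        poncelet_polygon (Gamma0 (Cplx R)) (confocal a t) P) /\
     (forall la : Cplx R,
        cubic (a - t) la =
        (a - t) * (a - t - 4^-1) * \det (confocal a t + la *: Gamma0 (Cplx R)))) /\
  (forall s la : Cplx R, U s -> s != 0 -> 4 * s - 1 != 0 ->
     cubic s la = - (4^-1) * s * (4 * s - 1)
       * (la - lambda1 s) * (la - lambda2 r s) * (la - lambda3 r s)) /\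
  (* the solution is obtained from this family *)
  (forall s0 : Cplx R, U s0 -> den6 r s0 != 0 -> derive1 (x6 r) s0 != 0 ->
     x6 r s0 != 0 -> x6 r s0 != 1 ->
     [/\ lambda1 s0 != lambda2 r s0,
         x6 r s0 = (lambda3 r s0 - lambda1 s0) / (lambda2 r s0 - lambda1 s0),
         y0 r s0 = 32 * s0 / den6 r s0
       & exists f0 : Cplx R -> Cplx R,
           [/\ locally_function_of (x6 r) (y0 r) s0 f0,
               okamoto_den (x6 r s0) (y0 r s0) (derive1 f0 (x6 r s0)) != 0
             & y6 r s0 =
               okamoto (x6 r s0) (y0 r s0) (derive1 f0 (x6 r s0))]]).
Proof.
split; [|split; [|split]].
- move=> s0 Us0 den0 _ x0 x1 y60 _ _.
  exact: (@painleve6_solution R[i] U r hr s0 Us0 den0 x0 x1 y60).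
- move=> a t s0 s14; split; first exact: (@exists_hexagon R[i] a t s0 s14).
  by move=> la; exact: cubic_det.
- by move=> s la Us s0 s14; exact (cubic_roots hr Us la s0 s14).
move=> s0 Us0 den0 _ x0 x1.
exact: (@okamoto_solution R[i] U r hr s0 Us0 den0 x0 x1).
Qed.
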